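(* Let $(X,\rho)$ be a Hadamard space, let $K \subset X$ be nonempty, closed and convex, and let $F : K\times K \to \mathbb{R}$ be a bifunction satisfying: (A1) $F(x,x) \geq 0$ for each $x\in K$; (A2) for every $x \in K$, the set $\{y \in K : F(x,y) < 0\}$ is convex; (A3) for every $y \in K$, the function $x \mapsto F(x,y)$ is upper semicontinuous on $K$; (A4) there exists a compact subset $L \subset K$ containing a point $y_0 \in L$ such that $F(x,y_0) < 0$ whenever $x \in K\setminus L$. Then the equilibrium problem of finding $\bar x\in K$ such that $F(\bar x,y)\ge 0$ for every $y\in K$ has a solution, and its solution set $\mathcal{E}(K,F)$ is closed. In addition, if the function $x \mapsto F(x,y)$ is quasi-concave for every fixed $y \in K$, then $\mathcal{E}(K,F)$ is convex.
   Context: A Hadamard space is a complete CAT(0) space. For $x,y\in X$, $\gamma_{x,y}:[0,1]\to X$ is the normalized (constant speed) geodesic from $x$ to $y$. A set is convex if it contains the geodesic segment joining any two of its points. A function $h:K\to\mathbb{R}$ on a convex set is quasi-convex if $h\circ\gamma_{x,y}:[0,1]\to\mathbb{R}$ is quasi-convex for all $x,y\in K$, and quasi-concave if $-h$ is quasi-convex. $\mathcal{E}(K,F) := \{\bar x\in K : F(\bar x,y)\ge 0 \ \forall y\in K\}$. *)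

(* Defs.v *)
From HB Require Import structures.
From mathcomp Require Import all_boot all_order all_algebra.
From mathcomp Require Import all_classical all_reals all_analysis.

Set Implicit Arguments.
Unset Strict Implicit.
Unset Printing Implicit Defensive.

Import Order.TTheory GRing.Theory Num.Theory.
Import numFieldNormedType.Exports.

Local Open Scope classical_set_scope.
Local Open Scope ring_scope.

(* The library norm on 'rV[R]_2 is the sup norm, so the Euclidean distance
   has to be spelled out. *)
Definition euclid_dist (R : realType) (a b : 'rV[R]_2) : R :=
  Num.sqrt (\sum_(i < 2) (a ord0 i - b ord0 i) ^+ 2).

(* A constant speed path [0, 1] -> X, encoded as a function on R whose values
   outside [0, 1] are irrelevant. *)
Definition geodesic (R : realType) (X : metricType R) (x y : X) (g : R -> X) :
    Prop :=
  [/\ g 0 = x, g 1 = y &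
      forall s t : R, 0 <= s <= 1 -> 0 <= t <= 1 ->
        mdist (g s) (g t) = `|s - t| * mdist x y].

Definition geodesic_space (R : realType) (X : metricType R) : Prop :=
  forall x y : X, exists g : R -> X, geodesic x y g.

Definition comparison_triangle (R : realType) (X : metricType R)
    (p q r : X) (p' q' r' : 'rV[R]_2) : Prop :=
  [/\ euclid_dist p' q' = mdist p q,
      euclid_dist q' r' = mdist q r &
      euclid_dist r' p' = mdist r p].

(* Every geodesic triangle is at least as thin as its comparison triangles.
   Two distinct sides of a triangle share a vertex, so up to relabelling the
   vertices and reversing the sides it is enough to compare a point of a side
   [p, q] with a point of a side [p, r]; on a single side the comparison is an
   equality. *)
Definition CAT0 (R : realType) (X : metricType R) : Prop :=
  geodesic_space X /\
  forall (p q r : X) (g h : R -> X) (p' q' r' : 'rV[R]_2),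
    geodesic p q g -> geodesic p r h -> comparison_triangle p q r p' q' r' ->
    forall s t : R, 0 <= s <= 1 -> 0 <= t <= 1 ->
      mdist (g s) (h t) <= euclid_dist ((1 - s) *: p' + s *: q')
                                       ((1 - t) *: p' + t *: r').

(* The axiom [cauchy_cvg] of completeType, with [cvg F] unfolded: both require
   a distinguished point, which a metricType does not have. *)
Definition complete_space (R : realType) (X : metricType R) : Prop :=
  forall F : set_system X, ProperFilter F -> cauchy F ->
    exists x : X, F --> x.

Definition hadamard_space (R : realType) (X : metricType R) : Prop :=
  complete_space X /\ CAT0 X.

(* In a CAT(0) space the geodesic from x to y is unique, so here and in
   [quasi_convex] quantifying over all of them amounts to using that one. *)
Definition geodesically_convex (R : realType) (X : metricType R) (A : set X) :
    Prop :=
  forall (x y : X) (g : R -> X), A x -> A y -> geodesic x y g ->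
    forall t : R, 0 <= t <= 1 -> A (g t).

Definition quasi_convex_unit (R : realType) (f : R -> R) : Prop :=
  forall s t l : R, 0 <= s <= 1 -> 0 <= t <= 1 -> 0 <= l <= 1 ->
    f ((1 - l) * s + l * t) <= Num.max (f s) (f t).

Definition quasi_convex (R : realType) (X : metricType R) (K : set X)
    (h : X -> R) : Prop :=
  forall (x y : X) (g : R -> X), K x -> K y -> geodesic x y g ->
    quasi_convex_unit (h \o g).

Definition quasi_concave (R : realType) (X : metricType R) (K : set X)
    (h : X -> R) : Prop :=
  quasi_convex K (fun x => - h x).

Definition upper_semicontinuous_on (R : realType) (X : metricType R)
    (K : set X) (h : X -> R) : Prop :=
  forall (x : X) (a : R), K x -> h x < a ->
    \forall z \near within K (nbhs x), h z < a.

(* A bifunction K * K -> R is encoded as a function on X * X of which only the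
   values on K * K matter. *)
Definition equilibria (R : realType) (X : metricType R) (K : set X)
    (F : X -> X -> R) : set X :=
  [set x | K x /\ forall y : X, K y -> 0 <= F x y].

(* Main.v *)
Require Import Defs.
From HB Require Import structures.
From mathcomp Require Import all_boot all_order all_algebra.

Set Implicit Arguments.
Unset Strict Implicit.
Unset Printing Implicit Defensive.

(* The sets G(y) = {x in K | 0 <= F x y} are closed, and by (A1) and (A2) the
   convex hull of finitely many y_i is covered by the G(y_i), so the existence
   of an equilibrium is a KKM principle together with the compactness of
   G(y_0), which lies in L.  Iterated geodesic cones over the y_i give a
   Lipschitz map from a simplex to X sending every face into the hull of its
   vertices (CAT(0) comparison makes geodesics from a common point spread at
   most linearly), which reduces the principle to a simplex.  There, with d_i
   the distance of the image of x to G(y_i), the field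
   d_i - x_i (d_0 + .. + d_n) points inwards on the boundary; it has a zero by
   a Brouwer-type argument based on Scarf's combinatorial lemma for linear
   orders, and at such a zero all the d_i vanish. *)

(** * Scarf's lemma *)

Section Scarf.
Variables (I V : finType) (f : I -> V -> nat) (s : I -> V) (c : V -> I).
Hypothesis f_inj : forall i, injective (f i).
Hypothesis cs : cancel s c.
Hypothesis s_min : forall i v, f i (s i) <= f i v.
Hypothesis s_max : forall i j v, i != j -> (forall k, v != s k) ->
  f j v < f j (s i).

(* Scarf's primitive sets: [V] carries one linear order per index [i], given by
   the injective height [f i], and [s i] is the slack vector of [i], lowest for
   [i] and above every non-slack point for the other indices. *)
Definition dominant (A : {set V}) :=
  [forall v, exists i, [forall a in A, f i v <= f i a]].

Let dominantP (A : {set V}) :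
  reflect (forall v, exists i, forall a, a \in A -> f i v <= f i a)
    (dominant A).
Proof.
apply: (iffP forallP) => H v.
  by have /existsP[i /forall_inP Hi] := H v; exists i.
by have [i Hi] := H v; apply/existsP; exists i; apply/forall_inP.
Qed.

Let dominantS (A B : {set V}) : A \subset B -> dominant B -> dominant A.
Proof.
move=> /subsetP AB /dominantP domB; apply/dominantP => v.
by have [i Hi] := domB v; exists i => a /AB; apply: Hi.
Qed.

Lemma odd_card_doors (i0 : I) (A : {set V}) : #|A| = #|I| ->
  odd #|[set a in A | c @: (A :\ a) == ~: [set i0]]| = (c @: A == setT).
Proof.
move=> cA.
have cI : #|~: [set i0]| = #|I|.-1.
  by have := cardsC [set i0]; rewrite cards1 => <-.
have inj_sub (a : V) : a \in A -> c @: (A :\ a) = ~: [set i0] ->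
    {in A :\ a &, injective c}.
  move=> aA E; apply/imset_injP; rewrite E cI.
  by have := cardsD1 a A; rewrite aA cA => ->.
have [cAT|cAN] := eqVneq (c @: A) setT.
  have inj : {in A &, injective c} by apply/imset_injP; rewrite cAT cardsT cA.
  have /imsetP[a aA ea] : i0 \in c @: A by rewrite cAT inE.
  suff -> : [set a in A | c @: (A :\ a) == ~: [set i0]] = [set a].
    by rewrite cards1.
  apply/setP => x; rewrite !inE; apply/andP/eqP => [[xA /eqP E]|->].
    apply/eqP; apply: contraT => xa.
    have : i0 \in c @: (A :\ x) by rewrite ea imset_f // !inE eq_sym xa.
    by rewrite E !inE eqxx.
  split=> //; apply/eqP/setP => j; rewrite !inE.
  apply/imsetP/idP => [[y]|ji].
    rewrite !inE => /andP[ya yA] ->; rewrite ea.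
    by apply: contra ya => /eqP/inj->.
  have /imsetP[y yA ey] : j \in c @: A by rewrite cAT inE.
  exists y => //; rewrite !inE yA andbT.
  by apply: contra ji => /eqP ya; rewrite ey ya ea.
have [-> |] := eqVneq [set a in A | c @: (A :\ a) == ~: [set i0]] set0.
  by rewrite cards0.
case/set0Pn=> a; rewrite inE => /andP[aA /eqP Ea].
have inja := inj_sub a aA Ea.
have cai : c a != i0.
  apply: contra cAN => /eqP cai; rewrite -(setD1K aA) imsetU1 Ea cai.
  by rewrite setUCr.
have /imsetP[b] : c a \in c @: (A :\ a) by rewrite Ea !inE.
rewrite !inE => /andP[ba bA] eab.
have Eb : c @: (A :\ b) = ~: [set i0].
  have abA : a \in A :\ b by rewrite !inE eq_sym ba.
  have baA : b \in A :\ a by rewrite !inE ba.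
  rewrite -Ea -(setD1K abA) -[in RHS](setD1K baA) !imsetU1 eab.
  by rewrite !setDDl [[set b] :|: _]setUC.
suff -> : [set a in A | c @: (A :\ a) == ~: [set i0]] = [set a; b].
  by rewrite cards2 eq_sym ba.
apply/setP => x; rewrite !inE.
apply/andP/orP => [[xA /eqP Ex]|[/eqP->|/eqP->]]; rewrite ?Ea ?Eb //.
apply/orP; apply: contraT; rewrite negb_or => /andP[xa xb].
have : c x \in c @: (A :\ x).
  rewrite Ex -Ea; apply: imset_f; by rewrite !inE xa.
case/imsetP=> y; rewrite !inE => /andP[yx yA] exy.
have xA' : x \in A :\ a by rewrite !inE xa.
have [ya|ya] := eqVneq y a.
  have : x = b by apply: inja; rewrite // ?inE ?ba // exy ya.
  by move/eqP; rewrite (negbTE xb).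
have : x = y by apply: inja; rewrite // !inE ya.
by move/esym/eqP; rewrite (negbTE yx).
Qed.

(* A door is a dominant set of [#|I| - 1] points with colours [~: [set i0]].
   Exactly two indices [i], [j] share their lowest point in it; dropping the
   constraint of one of them allows for at most one new point, the highest of
   those exceeding the door for all the other indices. *)
Section Door.
Variable D : {set V}.
Hypotheses (cD : #|D|.+1 = #|I|) (domD : dominant D).
Variable m : I -> V.
Hypothesis mD : forall i, m i \in D.
Hypothesis m_min : forall i a, a \in D -> f i (m i) <= f i a.
Variables i j : I.
Hypotheses (ij : i != j) (mij : m i = m j).

Let mE l a : a \in D -> (forall b, b \in D -> f l a <= f l b) -> a = m l.
Proof.
move=> aD amin; apply: (@f_inj l); apply/eqP.
by rewrite eqn_leq amin ?m_min.
Qed.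

Let beyond k := [set v | [forall l, (l != k) ==> (f l (m l) < f l v)]].

Let beyondP k v : reflect (forall l, l != k -> f l (m l) < f l v)
  (v \in beyond k).
Proof. by rewrite inE; apply: (iffP forall_inP). Qed.

Let m_onto k a : k \in [set i; j] -> a \in D -> exists2 l, l != k & a = m l.
Proof.
move=> kij aD; have /dominantP/(_ a)[l al] := domD.
have am := mE aD al.
have [lk|lk] := eqVneq l k; last by exists l.
rewrite am lk; move: kij; rewrite !inE => /orP[]/eqP->.
  by exists j => //; rewrite eq_sym.
by exists i.
Qed.

Let far k := [set v in beyond k | [forall u in beyond k, f k u <= f k v]].

Let card_far k : #|far k| = (beyond k != set0).
Proof.
case: (set0Pn (beyond k)) => [[v0 v0S]|no]; last first.
  apply/eqP; rewrite cards_eq0; apply/eqP/setP=> v; rewrite in_set0.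
  by apply/negP; rewrite inE => /andP[vS _]; apply: no; exists v.
case: (@arg_maxnP _ v0 (mem (beyond k)) (f k) v0S) => v vS vmax.
suff -> : far k = [set v] by rewrite cards1.
apply/setP => x; rewrite in_set1 in_set.
apply/andP/eqP => [[xS /forall_inP xmax]|->]; last first.
  by split=> //; apply/forall_inP => u uS; apply: vmax.
by apply: (@f_inj k); apply/eqP; rewrite eqn_leq xmax // andbT; apply: vmax.
Qed.

(** A new point [v] is lowest for some [k], so the points of [D] are lowest for indices other than
    [k]. By cardinality [m] is injective off [k], and [m i = m j] forces [k] to be [i] or [j]. *)
Let extensions_door :
  [set v | (v \notin D) && dominant (v |: D)] = far i :|: far j.
Proof.
apply/setP => v; rewrite in_setU inE; apply/andP/idP.
- case=> vD /dominantP dv.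
  have [k kv] := dv v.
  have onto a : a \in D -> exists l, [/\ l != k, a = m l & f l a < f l v].
    move=> aD; have [l al] := dv a; exists l.
    have alv : f l a < f l v.
      rewrite ltn_neqAle al ?setU11 // andbT.
      by apply: contra vD => /eqP/f_inj<-.
    split=> //; last by apply: mE => // b bD; apply: al; rewrite setU1r.
    apply: contraTN alv => /eqP->; rewrite -leqNgt; apply: kv.
    by rewrite setU1r.
  have mk : m @: (~: [set k]) = D.
    apply/setP => a; apply/imsetP/idP => [[l _ ->]//|/onto[l [lk al _]]].
    by exists l => //; rewrite !inE.
  have minj : {in ~: [set k] &, injective m}.
    apply/imset_injP; rewrite mk -eqSS cD.
    by rewrite -(cardsC [set k]) cards1.
  have vS : v \in beyond k.
    apply/beyondP => l lk.
    have [l' [l'k e]] := onto _ (mD l).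
    by rewrite (minj _ _ _ _ e) // !inE.
  have vF : v \in far k.
    rewrite inE vS; apply/forall_inP => u /beyondP uS.
    have [l lu] := dv u.
    have [lk|/uS] := eqVneq l k; first by rewrite -lk lu ?setU11.
    by rewrite ltnNge lu // setU1r.
  apply/orP; have [<-|ik] := eqVneq k i; first by left.
  have [<-|jk] := eqVneq k j; first by right.
  have : i = j by apply: minj; rewrite // !inE eq_sym.
  by move/eqP; rewrite (negbTE ij).
- move=> vF.
  have {vF}[k kij] : exists2 k, k \in [set i; j] & v \in far k.
    by case/orP: vF => vF; [exists i|exists j]; rewrite // !inE eqxx ?orbT.
  rewrite inE => /andP[/beyondP vS /forall_inP vmax]; split.
    apply/negP => /(m_onto kij)[l lk vE].
    by have := vS l lk; rewrite -vE ltnn.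
  apply/dominantP => u.
  have [/[dup] uS /beyondP uS'|] := boolP (u \in beyond k).
    have /dominantP/(_ u)[l ul] := domD.
    have lk : l = k.
      apply/eqP; apply: contraT => /uS'.
      by rewrite ltnNge ul.
    exists k => a; rewrite !inE => /orP[/eqP->|]; first exact: vmax.
    by rewrite -lk; apply: ul.
  rewrite inE negb_forall => /existsP[l]; rewrite negb_imply -leqNgt.
  move=> /andP[lk ul]; exists l => a; rewrite !inE => /orP[/eqP->|aD].
    by rewrite (leq_trans ul) // ltnW // vS.
  by rewrite (leq_trans ul) // m_min.
Qed.

Let card_extensions : odd #|[set v | (v \notin D) && dominant (v |: D)]| =
  (beyond i != set0) (+) (beyond j != set0).
Proof.
rewrite extensions_door cardsU (_ : far i :&: far j = set0) ?cards0 ?subn0.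
  by rewrite !card_far oddD; do 2!case: (_ != _).
(* A point of both sets would exceed [m l] for every [l], against the dominance of [D]. *)
apply/setP => v; rewrite !inE; apply/negP => /andP[/andP[vi _] /andP[vj _]].
have /dominantP/(_ v)[l lv] := domD.
have : f l (m l) < f l v.
  have [li|li] := eqVneq l i.
    by move/forall_inP: vj; apply; rewrite li.
  by move/forall_inP: vi; apply.
by rewrite ltnNge lv.
Qed.

(** Each slack vector [s k] lies above [w] for all other indices, so both [beyond i] and [beyond j]
    are inhabited. *)
Lemma odd_extensions_inner w : w \in D -> (forall k, w != s k) ->
  ~~ odd #|[set v | (v \notin D) && dominant (v |: D)]|.
Proof.
move=> wD ws; rewrite card_extensions.
suff H k : beyond k != set0 by rewrite !H.
apply/set0Pn; exists (s k); apply/beyondP => l lk.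
by rewrite (leq_ltn_trans (m_min l wD)) // s_max // eq_sym.
Qed.

(** Off [i0] the lowest points are the slack vectors themselves, so one of [i], [j] is [i0]. The set
    [beyond i0] contains [w], while [beyond] is empty at the other index. *)
Lemma odd_extensions_outer i0 w : D = s @: (~: [set i0]) ->
  (forall k, w != s k) ->
  odd #|[set v | (v \notin D) && dominant (v |: D)]|.
Proof.
move=> DE ws; have s_inj := can_inj cs.
have ms l : l != i0 -> m l = s l.
  move=> li; apply/esym/mE => //; first by rewrite DE imset_f // !inE.
have i0S : beyond i0 != set0.
  apply/set0Pn; exists w; apply/beyondP => l li; rewrite ms //.
  rewrite ltn_neqAle s_min andbT; apply: contra (ws l).
  by move=> /eqP/f_inj->.
have kS k : k != i0 -> m k = m i0 -> beyond k == set0.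
  move=> ki mk; apply/eqP/setP => v; rewrite in_set0.
  apply/negP => /beyondP vS.
  have := vS i0; rewrite eq_sym ki -mk ms // => /(_ isT) vi0.
  have [/existsP[p /eqP vp]|] := boolP [exists p, v == s p]; last first.
    rewrite negb_exists => /forallP/(s_max ki)/ltnW.
    by rewrite leqNgt vi0.
  have [pk|pk] := eqVneq p k; first by rewrite vp pk ltnn in vi0.
  have [pi|pi] := eqVneq p i0.
    by rewrite vp pi ltnNge s_min in vi0.
  by have := vS p pk; rewrite ms // -vp ltnn.
rewrite card_extensions.
have [E|ii] := eqVneq i i0.
  by rewrite E i0S kS // -?E // eq_sym.
have [E|jj] := eqVneq j i0.
  by rewrite E i0S (eqP (kS i _ _)) // -?E // eqxx.
by move: mij; rewrite !ms // => /s_inj/eqP; rewrite (negbTE ij).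
Qed.

End Door.

(** Having fewer points than indices, [D] has a point that is lowest for two indices. If [D]
    consists of slack vectors only, its colours determine it. *)
Lemma odd_extensions (i0 : I) (D : {set V}) w : 1 < #|I| ->
  (forall k, w != s k) ->
  #|D|.+1 = #|I| -> dominant D -> c @: D = ~: [set i0] ->
  odd #|[set v | (v \notin D) && dominant (v |: D)]| =
    (D == s @: (~: [set i0])).
Proof.
move=> I2 ws cD domD cDE.
have /card_gt0P[x0 x0D] : 0 < #|D| by rewrite -ltnS cD.
pose m i := [arg min_(a < x0 in D) f i a].
have mD i : m i \in D by rewrite /m; case: arg_minnP.
have m_min i a : a \in D -> f i (m i) <= f i a.
  by rewrite /m; case: arg_minnP => // b _ H /H.
have [i [j [ij mij]]] : exists i j, i != j /\ m i = m j.
  have /injectivePn[i [j ij mij]] : ~~ injectiveb m.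
    apply/negP => /injectiveP minj.
    have : #|m @: setT| <= #|D|.
      by apply/subset_leq_card/subsetP => _ /imsetP[k _ ->].
    by rewrite card_imset // cardsT -cD ltnn.
  by exists i, j.
have [DE|DN] := eqVneq D (s @: (~: [set i0])).
  exact: (odd_extensions_outer cD domD mD m_min ij mij DE ws).
have [/existsP[v /andP[vD vs]]|] := boolP [exists v in D, [forall k, v != s k]].
  apply/negbTE/(odd_extensions_inner cD domD mD m_min ij mij vD).
  exact/forallP.
rewrite negb_exists => /forallP H; case/eqP: DN.
have DV v : v \in D -> v = s (c v).
  move=> vD; have := H v; rewrite vD negb_forall => /existsP[k].
  by rewrite negbK => /eqP->; rewrite cs.
apply/setP => v; apply/idP/imsetP => [vD|[k]].
  by exists (c v); [rewrite -cDE imset_f|apply: DV].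
by rewrite -cDE => /imsetP[u uD ->] ->; rewrite -DV.
Qed.

(* Double count of the pairs (dominant set of [#|I|] points, door inside it):
   every door lies in an even number of such sets, except for the one made of
   slack vectors only. *)
Lemma rainbow_dominant w : 1 < #|I| -> (forall k, w != s k) ->
  exists A : {set V}, c @: A = setT /\ dominant A /\ #|A| = #|I|.
Proof.
move=> I2 ws; have /card_gt0P[i0 _] : 0 < #|I| by apply: ltnW.
pose cell (A : {set V}) := (#|A| == #|I|) && dominant A.
pose E a (A : {set V}) := c @: (A :\ a) == ~: [set i0].
have count : \sum_(A | cell A) #|[set a in A | E a A]| =
    \sum_(D : {set V} |
        [&& #|D|.+1 == #|I|, dominant D & c @: D == ~: [set i0]])
       #|[set v | (v \notin D) && dominant (v |: D)]|.
  under eq_bigr do rewrite -sum1_card.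
  under [RHS]eq_bigr do rewrite -sum1_card.
  rewrite (exchange_big_dep predT) //= [RHS](exchange_big_dep predT) //=.
  apply: eq_bigr => a _.
  (* For fixed [a], the sets [A] containing [a] correspond to the sets [D = A :\ a] avoiding it. *)
  rewrite (reindex_onto (fun D => a |: D) (fun A => A :\ a)) /=; last first.
    by move=> A /andP[_]; rewrite inE => /andP[aA _]; rewrite setD1K.
  apply: eq_bigl => D; rewrite !inE eqxx /= /cell /E cardsU1.
  have [aD|aD] := boolP (a \in D) => /=.
    rewrite ?andbF; apply/negbTE; rewrite negb_and; apply/orP; right.
    by apply: contraTN aD => /eqP<-; rewrite !inE eqxx.
  rewrite setU1K // eqxx andbT add1n /=.
  case: (_ == _) => //=; case dv : (dominant (_ |: _)); rewrite ?andbF //=.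
  by rewrite (dominantS _ dv) ?subsetUr ?andbT.
have sD0 : [&& #|s @: (~: [set i0])|.+1 == #|I|, dominant (s @: (~: [set i0]))
     & c @: (s @: (~: [set i0])) == ~: [set i0]].
  apply/and3P; split.
  - by rewrite (card_imset _ (can_inj cs)) -(cardsC [set i0]) cards1.
  - apply/dominantP => v.
    have [/existsP[p /eqP->]|] := boolP [exists p, v == s p].
      by exists p => a _; apply: s_min.
    rewrite negb_exists => /forallP vs.
    exists i0 => _ /imsetP[k ki ->]; apply/ltnW/s_max => //.
    by move: ki; rewrite !inE.
  - by rewrite -imset_comp (eq_imset _ cs) imset_id.
have : odd (\sum_(A | cell A) #|[set a in A | E a A]|).
  rewrite count (bigD1 (s @: (~: [set i0]))) //= oddD.
  have /and3P[/eqP cD dD /eqP cDE] := sD0.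
  rewrite (odd_extensions I2 ws cD dD cDE) eqxx /=.
  apply: (big_ind (fun x => ~~ odd x)) => // [x y|D].
    by rewrite oddD; case: (odd x); case: (odd y).
  case/andP=> /and3P[/eqP cD' dD' /eqP cDE'] /negbTE DN.
  by rewrite (odd_extensions I2 ws cD' dD' cDE') DN.
have [/existsP[A /andP[/andP[/eqP cA dA] /eqP cT]] _|no] :=
  boolP [exists A, cell A && (c @: A == setT)]; first by exists A.
move=> oddS.
suff /negP : ~~ odd (\sum_(A | cell A) #|[set a in A | E a A]|) by [].
apply: (big_ind (fun x => ~~ odd x)) => // [x y|A Ac].
  by rewrite oddD; case: (odd x); case: (odd y).
rewrite odd_card_doors; last by case/andP: Ac => /eqP.
apply: contra no => cT; apply/existsP; exists A; exact/andP.
Qed.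

End Scarf.

(** * Labelled grid points of the simplex *)

Section SimplexGrid.
Variables (I : finType) (N : nat).

Let grid := {t : {ffun I -> 'I_N.+1} | \sum_i (t i : nat) == N}.
Let pt (t : grid) (i : I) : nat := val t i.

(* Coordinates, with ties broken by the enumeration of the grid. *)
Let height (i : I) (v : grid + I) : nat :=
  match v with
  | inl t => (pt t i * #|{: grid}| + enum_rank t).+1
  | inr j => if j == i then 0 else (N.+1 * #|{: grid}| + enum_rank j).+1
  end.

Let height_lt i (t : grid) :
  pt t i * #|{: grid}| + enum_rank t < N.+1 * #|{: grid}|.
Proof.
apply: (@leq_trans ((pt t i).+1 * #|{: grid}|)).
  by rewrite mulSn addnC ltn_add2r.
by rewrite leq_mul2r ltn_ord orbT.
Qed.

Let height_ltn i (t u : grid) :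
  pt t i < pt u i -> height i (inl t) < height i (inl u).
Proof.
move=> tu; rewrite /height ltnS.
apply: (@leq_trans ((pt t i).+1 * #|{: grid}|)).
  by rewrite mulSn addnC ltn_add2r.
by rewrite (leq_trans _ (leq_addr _ _)) // leq_mul2r tu orbT.
Qed.

Let height_inj i : injective (height i).
Proof.
move=> [t|j] [u|k] /= => [[E]|||].
- congr inl; apply: enum_rank_inj; apply: val_inj => /=.
  have /(congr1 (modn^~ #|{: grid}|)) := E.
  by rewrite !modnMDl !modn_small.
- case: ifP => // _ [E].
  by have := height_lt i t; rewrite E ltnNge leq_addr.
- case: ifP => // _ [E].
  by have := height_lt i u; rewrite -E ltnNge leq_addr.
- case: ifP => [/eqP->|_]; case: ifP => [/eqP->|_] //.
  by move=> [/addnI/val_inj/enum_rank_inj->].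
Qed.

Let of_nat_fun (a : I -> nat) : \sum_i a i = N -> exists t : grid, pt t =1 a.
Proof.
move=> aN.
have aE i : ([ffun i => inord (a i)] : {ffun I -> 'I_N.+1}) i = a i :> nat.
  by rewrite ffunE inordK // ltnS -aN (bigD1 i) //= leq_addr.
pose P (t : {ffun I -> 'I_N.+1}) := \sum_i (t i : nat) == N.
have aP : P [ffun i => inord (a i)].
  by rewrite /P; under eq_bigr do rewrite aE; rewrite aN.
by exists (@exist _ P _ aP) => i; rewrite /pt /= aE.
Qed.

(** The grid points of a rainbow dominant set are within [#|I|] of each other in every coordinate. A
    colour that none of them carries comes from its slack vector, and then the corresponding
    coordinate is small. *)
Lemma labelled_grid (lab : (I -> nat) -> I) : 1 < #|I| ->
  exists a : I -> nat, \sum_i a i = N /\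
  forall i, a i <= #|I| \/ exists b : I -> nat,
    [/\ \sum_i b i = N, lab b = i
      & forall j, a j <= b j + #|I| /\ b j <= a j + #|I|].
Proof.
move=> I2; have /card_gt0P[i0 _] : 0 < #|I| by apply: ltnW.
have [w0 _] : exists t : grid, pt t =1 fun i => if i == i0 then N else 0.
  apply: of_nat_fun; rewrite (bigD1 i0) //= eqxx big1 ?addn0 // => i.
  by move/negbTE->.
pose c (v : grid + I) := match v with inl t => lab (pt t) | inr i => i end.
have cs : cancel (@inr grid I) c by [].
have smin i v : height i (inr i) <= height i v by rewrite /= eqxx.
have smax i j v : i != j -> (forall k, v != inr k) ->
    height j v < height j (inr i).
  case: v => [t|k] /negbTE ij H; last by have := H k; rewrite eqxx.
  by rewrite /= ij ltnS (leq_trans (height_lt j t)) // leq_addr.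
have [A [cA [/forallP dA _]]] :
    exists A : {set grid + I},
      c @: A = setT /\ dominant height A /\ #|A| = #|I|.
  by apply: (rainbow_dominant height_inj cs smin smax (w := inl w0)).
pose C := [set i | inr i \notin A].
have domA (t : grid) : exists2 i, i \in C &
    forall u : grid, inl u \in A -> pt t i <= pt u i.
  have /existsP[i /forall_inP it] := dA (inl t).
  exists i.
    (* The slack vector of [i] has height 0 for [i], below every grid point. *)
    by rewrite inE; apply/negP => /it; rewrite /= eqxx.
  move=> u /it; apply: contraLR; rewrite -!ltnNge; exact: height_ltn.
have labC i : i \in C -> exists2 t : grid, inl t \in A & lab (pt t) = i.
  rewrite inE => iA; have : i \in c @: A by rewrite cA inE.
  case/imsetP => -[t tA ->|j jA ij]; first by exists t.
  by move: iA; rewrite ij /= jA.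
have [i1 i1C _] := domA w0; have [a aA _] := labC i1 i1C.
pose mn i := pt [arg min_(u < a | inl u \in A) pt u i] i.
have mn_le i u : inl u \in A -> mn i <= pt u i.
  by rewrite /mn; case: arg_minnP => // v _ H /H.
have mn_ex i : exists2 u : grid, inl u \in A & pt u i = mn i.
  by rewrite /mn; case: arg_minnP => // v vA _; exists v.
have sum_pt (t : grid) : \sum_i pt t i = N by apply/eqP/(valP t).
have mnN : N < \sum_(i in C) mn i + #|C|.
  (* Otherwise the grid point with coordinates [mn i + 1] on [C], the excess being put on [i1],
     would exceed the minimum over [A] in every coordinate of [C], against [domA]. *)
  rewrite ltnNge -sum1_card -big_split /=; apply/negP => le.
  have [t tE] : exists t : grid, pt t =1 fun i =>
      (if i \in C then mn i + 1 else 0) +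
      (if i == i1 then N - \sum_(i in C) (mn i + 1) else 0).
    apply: of_nat_fun; rewrite big_split /= -big_mkcond /=.
    rewrite [X in _ + X](bigD1 i1) //= eqxx [X in _ + (_ + X)]big1.
      by rewrite addn0 subnKC.
    by move=> i /negbTE->.
  have [i iC it] := domA t; have [u uA uE] := mn_ex i.
  have := it u uA; rewrite uE tE iC addn1 => H.
  by have := leq_ltn_trans (leq_addr _ _) H; rewrite ltnn.
have CI : #|C| <= #|I| by rewrite max_card.
(* Coordinates sum to [N] and the minima over [C] use up more than [N - #|C|], so little is left for
   any other share. *)
have outC u j : inl u \in A -> j \notin C -> pt u j <= #|I|.
  move=> uA jC; rewrite -(leq_add2l (\sum_(i in C) mn i)).
  apply: (@leq_trans N); last first.
    by rewrite (leq_trans (ltnW mnN)) // leq_add2l.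
  rewrite -[leqRHS](sum_pt u) (bigID [in C] xpredT) /=; apply: leq_add.
    by apply: leq_sum => i _; apply: mn_le.
  by rewrite (bigD1 j) //= leq_addr.
have inC u j : inl u \in A -> j \in C -> pt u j <= mn j + #|I|.
  move=> uA jC.
  rewrite -(leq_add2l (\sum_(i in C | i != j) mn i)) addnA.
  rewrite [X in _ <= X + _]addnC -(bigD1 j) //=.
  apply: (@leq_trans N); last first.
    by rewrite (leq_trans (ltnW mnN)) // leq_add2l.
  rewrite -[leqRHS](sum_pt u) (bigID [in C] xpredT) /=.
  rewrite [X in _ <= X + _](bigD1 j) //= addnC -addnA leq_add2l.
  rewrite (leq_trans _ (leq_addr _ _)) //.
  by apply: leq_sum => i _; apply: mn_le.
exists (pt a); split=> // i.
have [iC|iC] := boolP (i \in C); last by left; apply: outC.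
right; have [t tA tl] := labC i iC.
exists (pt t); split=> // j.
have [jC|jC] := boolP (j \in C).
  split; first by rewrite (leq_trans (inC a j aA jC)) // leq_add2r mn_le.
  by rewrite (leq_trans (inC t j tA jC)) // leq_add2r mn_le.
split; first by rewrite (leq_trans (outC a j aA jC)) // leq_addl.
by rewrite (leq_trans (outC t j tA jC)) // leq_addl.
Qed.

End SimplexGrid.

From mathcomp Require Import all_classical all_reals all_analysis.
From mathcomp Require Import ring lra.

Import Order.TTheory GRing.Theory Num.Theory.
Import numFieldNormedType.Exports.

Local Open Scope classical_set_scope.
Local Open Scope ring_scope.

(** * The simplex *)

Definition simplex (R : realType) (n : nat) : set 'rV[R]_n :=
  [set x | (forall i, 0 <= x ord0 i) /\ \sum_i x ord0 i = 1].

Lemma simplex_le1 (R : realType) n (x : 'rV[R]_n) i :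
  simplex x -> x ord0 i <= 1.
Proof. by move=> [x0 <-]; rewrite (bigD1 i) //= lerDl sumr_ge0. Qed.

Lemma row_norm_le (R : realType) n (x : 'rV[R]_n) (e : R) : 0 <= e ->
  (forall i, `|x ord0 i| <= e) -> `|x| <= e.
Proof.
move=> e0 H; rewrite [leLHS]mx_normrE.
apply/bigmax_leP; split=> //= -[i j] _ /=.
by rewrite ord1.
Qed.

Lemma compact_simplex (R : realType) n : compact (@simplex R n).
Proof.
apply: bounded_closed_compact.
  exists 1; split=> // M M1 x xs /=.
  rewrite (le_trans _ (ltW M1)) // row_norm_le // => i.
  by rewrite ger0_norm ?simplex_le1 //; case: xs.
have -> : @simplex R n = (\bigcap_(i in setT) [set x | 0 <= x ord0 i]) `&`
    [set x | \sum_i x ord0 i = 1].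
  by apply/seteqP; split => x [H1 H2]; split=> // i *; apply: H1.
apply: closedI.
  apply: closed_bigI => i _.
  apply: (@preimage_closed _ _ (fun x : 'rV[R]_n => x ord0 i) [set y | 0 <= y]).
    by move=> x _; apply: coord_continuous.
  exact: closed_ge.
apply: (@preimage_closed _ _ (fun x : 'rV[R]_n => \sum_i x ord0 i)
  [set y | y = 1]).
  move=> x _; apply: (@continuous_big _ _ _ _ _ _ _ _
    (fun i (y : 'rV[R]_n) => y ord0 i)) => [|i _]; first exact: add_continuous.
  exact: coord_continuous.
exact: closed_eq.
Qed.

Lemma coord_le_norm (R : realType) n (x : 'rV[R]_n) i : `|x ord0 i| <= `|x|.
Proof.
rewrite [leRHS]mx_normrE.
exact: (le_bigmax _ (fun ij : 'I_1 * 'I_n => `|x ij.1 ij.2|) (ord0, i)).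
Qed.

(* [g_in] says that [g i] is nonnegative where [x i = 0], so that the field [g]
   points into the simplex on its boundary. *)
Section InwardField.
Variables (R : realType) (n : nat) (g : 'I_n -> 'rV[R]_n -> R) (L : R).
Hypothesis n2 : (1 < n)%N.
Hypothesis L0 : 0 <= L.
Hypothesis g_sum : forall x, simplex x -> \sum_i g i x = 0.
Hypothesis g_in : forall x i, simplex x -> - (L * x ord0 i) <= g i x.
Hypothesis g_lip : forall x y i, simplex x -> simplex y ->
  g i x - g i y <= L * `|x - y|.

(** Each grid point of mesh [1 / N] is labelled by an index where the field is nonnegative, which
    exists since the [g i] sum to zero. For each [i], the bound follows from [g_in] if the
    coordinate is small, and from [g_lip] if a point labelled [i] is near. *)
Lemma inward_almost_zero (N : nat) : (0 < N)%N ->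
  exists2 x, simplex x & forall i, - (L * (n%:R / N%:R)) <= g i x.
Proof.
move=> N0; have N0' : (0 : R) < N%:R by rewrite ltr0n.
pose pt (a : 'I_n -> nat) : 'rV[R]_n := \row_i ((a i)%:R / N%:R).
have pt_simplex a : (\sum_i a i)%N = N -> simplex (pt a).
  move=> aN; split=> [i|]; first by rewrite mxE divr_ge0.
  under eq_bigr do rewrite mxE.
  by rewrite -mulr_suml -natr_sum aN divff ?gt_eqF.
pose i0 : 'I_n := Ordinal (ltnW n2).
have nonneg x : simplex x -> exists i, 0 <= g i x.
  move=> xs; apply: contrapT => H.
  have Hlt i : g i x < 0 by rewrite ltNge; apply/negP => ?; apply: H; exists i.
  have := g_sum xs; apply/eqP; rewrite lt_eqF // (bigD1 i0) //=.
  by rewrite ltr_wnDr // sumr_le0 // => i _; apply: ltW.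
pose lab a := [pick i | 0 <= g i (pt a)].
pose lab' a := if lab a is Some i then i else i0.
have labP a : (\sum_i a i)%N = N -> 0 <= g (lab' a) (pt a).
  move=> /pt_simplex/nonneg[i gi]; rewrite /lab' /lab.
  by case: pickP => // /(_ i); rewrite gi.
have [|a [aN H]] := @labelled_grid 'I_n N lab'; first by rewrite card_ord.
exists (pt a) => [|i]; first exact: pt_simplex.
rewrite card_ord in H; have [ai|[b [bN bi ab]]] := H i.
  apply: le_trans (g_in _ (pt_simplex a aN)).
  by rewrite lerN2 ler_wpM2l // mxE ler_wpM2r ?invr_ge0 ?ler_nat.
have := g_lip i (pt_simplex b bN) (pt_simplex a aN).
have := labP b bN; rewrite bi => gb ga.
have : L * `|pt b - pt a| <= L * (n%:R / N%:R).
  rewrite ler_wpM2l // row_norm_le ?divr_ge0 // => j.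
  rewrite !mxE -mulrBl normrM [`|N%:R^-1|]ger0_norm ?invr_ge0 //.
  rewrite ler_wpM2r ?invr_ge0 // ler_norml; have [ab1 ab2] := ab j.
  move: ab1 ab2; rewrite -!(ler_nat R) !natrD => ab1 ab2.
  by apply/andP; split; lra.
lra.
Qed.

(** The image of the compact simplex under [e] is closed, so arbitrarily small values of [e]
    suffice. *)
Lemma inward_zero : exists2 x, simplex x & forall i, g i x = 0.
Proof.
pose e (x : 'rV[R]_n) := \sum_i `|g i x|.
have e_cont : {within @simplex R n, continuous e}.
  apply/subspace_continuousP => x xs; apply/cvgrPdist_le => r r0.
  pose k := n%:R * L + 1; have k0 : 0 < k by rewrite ltr_wpDl ?mulr_ge0.
  rewrite near_withinE; apply/nbhs_ballP; exists (r / k) => /=.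
    by rewrite divr_gt0.
  move=> y; rewrite -ball_normE /= => xy ys.
  rewrite -sumrB (le_trans (ler_norm_sum _ _ _)) //.
  apply: (@le_trans _ _ (\sum_(i < n) L * `|x - y|)).
    apply: ler_sum => i _; rewrite (le_trans (ler_dist_dist _ _)) //.
    by rewrite ler_norml g_lip // andbT lerNl opprB distrC g_lip.
  rewrite sumr_const card_ord -mulr_natl mulrA.
  apply: (@le_trans _ _ (k * `|x - y|)); first by rewrite ler_wpM2r // lerDl.
  by rewrite mulrC -ler_pdivlMr // ltW.
have cl : closed (e @` @simplex R n).
  apply: compact_closed; first exact: Rhausdorff.
  exact: continuous_compact e_cont (@compact_simplex R n).
suff [x xs ex] : (e @` @simplex R n) 0.
  exists x => // i; apply/eqP; rewrite -normr_eq0; apply/eqP.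
  by apply: (psumr_eq0P _ ex).
apply: cl => B /nbhs_ballP[r /= r0 rB].
(* Since the [g i] sum to zero, [g i x >= - eps] for all [i] yields [g i x <= n%:R * eps]. Hence
   [e x] is at most [n ^ 3 * L / N], which is below [r] once [N] exceeds [c]. *)
pose c := n%:R ^+ 3 * L / r.
have c0 : 0 <= c by rewrite divr_ge0 ?mulr_ge0 ?exprn_ge0 // ltW.
have [x xs gx] := @inward_almost_zero (Num.bound c).+1 isT.
set N := (Num.bound c).+1 in gx; set eps := L * _ in gx.
have N0 : 0 < N%:R :> R by rewrite ltr0n.
have eps0 : 0 <= eps by rewrite mulr_ge0 ?divr_ge0.
have n1 : 1 <= n%:R :> R by rewrite ler1n ltnW.
have g_le i : g i x <= n%:R * eps.
  have : \sum_j (g j x + eps) = n%:R * eps.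
    by rewrite big_split /= g_sum // add0r sumr_const card_ord mulr_natl.
  rewrite (bigD1 i) //= => <-; rewrite -addrA lerDl addr_ge0 //.
  by apply: sumr_ge0 => j _; rewrite -lerBlDr sub0r gx.
exists (e x); split; first by exists x.
apply: rB; rewrite -ball_normE /= sub0r normrN ger0_norm ?sumr_ge0 //.
apply: (@le_lt_trans _ _ (\sum_(i < n) n%:R * eps)).
  apply: ler_sum => i _; rewrite ler_norml g_le andbT (le_trans _ (gx i)) //.
  by rewrite lerN2 ler_peMl.
rewrite sumr_const card_ord -[ltLHS]mulr_natl /eps.
have -> : n%:R * (n%:R * (L * (n%:R / N%:R))) = c * r / N%:R.
  by rewrite /c divfK ?gt_eqF //; ring.
rewrite ltr_pdivrMr // mulrC ltr_pM2l //.
by rewrite (lt_trans (archi_boundP c0)) // ltr_nat.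
Qed.

End InwardField.

(* Where the field [d i - x i * \sum_j d j] vanishes, an index [i] with
   [0 < x i] and [d i = 0] forces the sum of the distances to be zero. *)
Lemma kkm_simplex (R : realType) (n : nat) (d : 'I_n -> 'rV[R]_n -> R)
    (L B : R) : (1 < n)%N -> 0 <= L -> 0 <= B ->
  (forall x i, simplex x -> 0 <= d i x <= B) ->
  (forall x y i, simplex x -> simplex y -> d i x - d i y <= L * `|x - y|) ->
  (forall x, simplex x -> exists i, 0 < x ord0 i /\ d i x = 0) ->
  exists2 x, simplex x & forall i, d i x = 0.
Proof.
move=> n2 L0 B0 dB dlip cover.
pose S x := \sum_i d i x.
pose g i x := d i x - x ord0 i * S x.
(* The three terms bound the variation of [d i], of [S] weighted by a coordinate at most 1, and of
   the coordinate weighted by [S]; the last one also serves for the inward condition. *)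
pose M := L + n%:R * L + n%:R * B.
have S_ge0 x : simplex x -> 0 <= S x.
  by move=> xs; apply: sumr_ge0 => i _; case/andP: (dB x i xs).
have S_le x : simplex x -> S x <= n%:R * B.
  move=> xs; apply: (@le_trans _ _ (\sum_(i < n) B)).
    by apply: ler_sum => i _; case/andP: (dB x i xs).
  by rewrite sumr_const card_ord mulr_natl.
have S_lip x y : simplex x -> simplex y -> S x - S y <= n%:R * L * `|x - y|.
  move=> xs ys; rewrite -sumrB.
  apply: (@le_trans _ _ (\sum_(i < n) L * `|x - y|)).
    by apply: ler_sum => i _; apply: dlip.
  by rewrite sumr_const card_ord -mulrA mulr_natl.
have M0 : 0 <= M by rewrite !addr_ge0 ?mulr_ge0.
have [|||x xs gx] := @inward_zero R n g M n2 M0.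
- move=> x xs; rewrite sumrB -mulr_suml.
  by case: xs => _ ->; rewrite mul1r subrr.
- move=> x i xs; have [x0 _] := xs; case/andP: (dB x i xs) => d0 _.
  rewrite -[leLHS]add0r lerD // lerN2 mulrC ler_wpM2r //.
  by rewrite (le_trans (S_le x xs)) // lerDr addr_ge0 ?mulr_ge0.
- move=> x y i xs ys.
  have -> : g i x - g i y = (d i x - d i y) + x ord0 i * (S y - S x) +
      (y ord0 i - x ord0 i) * S y by rewrite /g; ring.
  rewrite /M [leRHS]mulrDl [X in _ <= X + _]mulrDl !lerD // ?dlip //.
    have [x0 _] := xs.
    apply: (@le_trans _ _ (x ord0 i * (n%:R * L * `|x - y|))).
      by rewrite ler_wpM2l // distrC S_lip.
    by rewrite ler_piMl ?mulr_ge0 // simplex_le1.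
  rewrite [leRHS]mulrC; apply: (@le_trans _ _ (`|x - y| * S y)).
    rewrite ler_wpM2r ?S_ge0 // (le_trans (ler_norm _)) // distrC.
    have := coord_le_norm (x - y) i; by rewrite !mxE.
  by rewrite ler_wpM2l // S_le.
have [i [xi di]] := cover x xs.
have Sx : S x = 0.
  have /eqP := gx i; rewrite /g di sub0r oppr_eq0 mulf_eq0 gt_eqF //=.
  by move/eqP.
exists x => // j; have := gx j.
by rewrite /g Sx mulr0 subr0.
Qed.

(** * CAT(0) spaces *)

Section DistanceToSet.
Variables (R : realType) (X : metricType R) (A : set X).

Definition set_dist (x : X) : R := inf [set mdist x a | a in A].

Hypothesis A0 : A !=set0.

Let has_inf_dist x : has_inf [set mdist x a | a in A].
Proof.
split; first by case: A0 => a Aa; exists (mdist x a), a.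
by exists 0 => _ [a _ <-]; exact: mdist_ge0.
Qed.

Lemma set_dist_le x a : A a -> set_dist x <= mdist x a.
Proof.
by move=> Aa; apply: ge_inf; [case: (has_inf_dist x)|exists a].
Qed.

Lemma set_dist_ge0 x : 0 <= set_dist x.
Proof.
apply: lb_le_inf; first by case: (has_inf_dist x).
by move=> _ [a _ <-]; exact: mdist_ge0.
Qed.

Lemma set_dist_mem x : A x -> set_dist x = 0.
Proof.
move=> Ax; apply/eqP; rewrite eq_le set_dist_ge0 andbT.
by rewrite (le_trans (set_dist_le x Ax)) // mdistxx.
Qed.

Lemma set_dist_lipschitz x z : set_dist x - set_dist z <= mdist x z.
Proof.
rewrite lerBlDr -lerBlDl; apply: lb_le_inf; first by case: (has_inf_dist z).
move=> _ [a Aa <-]; rewrite lerBlDl.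
by rewrite (le_trans (set_dist_le x Aa)) // metric_triangle.
Qed.

Lemma set_dist_eq0 x : closed A -> set_dist x = 0 -> A x.
Proof.
move=> Acl dx; apply: Acl => B /nbhs_ballP[e /= e0 eB].
have [_ [a Aa <-] ae] := inf_adherent e0 (has_inf_dist x).
exists a; split=> //; apply: eB.
by move: ae; rewrite -/(set_dist x) dx add0r ballEmdist.
Qed.

End DistanceToSet.

(** * Comparison triangles in the Euclidean plane *)

Section Comparison.
Variable R : realType.

Let pt2 (a b : R) : 'rV[R]_2 := \row_j (if j == ord0 then a else b).

Let euclid_dist_pt2 a b c d :
  euclid_dist (pt2 a b) (pt2 c d) = Num.sqrt ((a - c) ^+ 2 + (b - d) ^+ 2).
Proof. by rewrite /euclid_dist !big_ord_recl big_ord0 !mxE /= addr0. Qed.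

(** Unless [p = q], place [p'] at the origin and [q'] on the first axis; the law of cosines gives
    the first coordinate [u] of [r']. Heron's factorization and the triangle inequalities make
    [b ^+ 2 - u ^+ 2] nonnegative. *)
Lemma comparison_triangle_exists (X : metricType R) (p q r : X) :
  exists p' q' r', comparison_triangle p q r p' q' r'.
Proof.
have [pq0|pq0] := eqVneq (mdist p q) 0.
  have pq := mdist_positivity _ _ pq0.
  exists (pt2 0 0), (pt2 0 0), (pt2 (mdist q r) 0).
  rewrite /comparison_triangle !euclid_dist_pt2 -pq mdistxx.
  split; first by rewrite !subrr expr0n /= addr0 sqrtr0.
  - by rewrite subrr sub0r sqrrN expr0n /= addr0 sqrtr_sqr ger0_norm ?mdist_ge0.
  - rewrite subrr subr0 expr0n /= addr0 sqrtr_sqr ger0_norm ?mdist_ge0 //.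
    by rewrite metric_sym.
set c := mdist p q in pq0 *; set a := mdist q r; set b := mdist r p.
have c0 : 0 < c by rewrite lt_neqAle eq_sym pq0 mdist_ge0.
have a0 : 0 <= a by apply: mdist_ge0.
have b0 : 0 <= b by apply: mdist_ge0.
have abc : a <= c + b.
  have := @metric_triangle R X q p r.
  by rewrite (@metric_sym R X q p) (@metric_sym R X p r).
have bac : b <= a + c.
  have := @metric_triangle R X r q p.
  by rewrite (@metric_sym R X r q) (@metric_sym R X q p).
have cab : c <= a + b.
  have := @metric_triangle R X p r q.
  by rewrite addrC (@metric_sym R X p r) (@metric_sym R X r q).
pose u := (b ^+ 2 + c ^+ 2 - a ^+ 2) / (2 * c).
have uE : u * (2 * c) = b ^+ 2 + c ^+ 2 - a ^+ 2.
  by rewrite /u divfK // mulf_neq0 // pnatr_eq0.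
have ub : 0 <= b ^+ 2 - u ^+ 2.
  have c2 : 0 < (2 * c) ^+ 2 by rewrite exprn_gt0 // mulr_gt0.
  rewrite -(pmulr_lge0 _ c2) mulrBl -!exprMn uE.
  have -> : (b * (2 * c)) ^+ 2 - (b ^+ 2 + c ^+ 2 - a ^+ 2) ^+ 2 =
    ((a + (c - b)) * (a - (c - b))) * ((b + c - a) * (b + c + a)) by ring.
  by rewrite !mulr_ge0 //; lra.
exists (pt2 0 0), (pt2 c 0), (pt2 u (Num.sqrt (b ^+ 2 - u ^+ 2))).
rewrite /comparison_triangle !euclid_dist_pt2; split.
- by rewrite subrr sub0r sqrrN expr0n /= addr0 sqrtr_sqr ger0_norm ?mdist_ge0.
- rewrite sub0r sqrrN sqr_sqrtr //.
  have -> : (c - u) ^+ 2 + (b ^+ 2 - u ^+ 2) = a ^+ 2.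
    have -> : (c - u) ^+ 2 + (b ^+ 2 - u ^+ 2) =
      c ^+ 2 + b ^+ 2 - u * (2 * c) by ring.
    by rewrite uE; ring.
  by rewrite sqrtr_sqr ger0_norm.
- by rewrite !subr0 sqr_sqrtr // addrC subrK sqrtr_sqr ger0_norm.
Qed.

(** At equal parameters the comparison points are the images of [q'] and [r'] under the homothety of
    centre [p'] and ratio [t]. *)
Lemma CAT0_fan (X : metricType R) (p q r : X) (g h : R -> X) (t : R) :
  CAT0 X -> geodesic p q g -> geodesic p r h -> 0 <= t <= 1 ->
  mdist (g t) (h t) <= t * mdist q r.
Proof.
move=> [_ cat] pq pr t01.
have [p' [q' [r' cmp]]] := comparison_triangle_exists p q r.
apply: le_trans (cat _ _ _ _ _ _ _ _ pq pr cmp _ _ t01 t01) _.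
have [_ <- _] := cmp; rewrite /euclid_dist.
have -> : \sum_(i < 2) (((1 - t) *: p' + t *: q') ord0 i -
    ((1 - t) *: p' + t *: r') ord0 i) ^+ 2 =
    t ^+ 2 * \sum_(i < 2) (q' ord0 i - r' ord0 i) ^+ 2.
  by rewrite mulr_sumr; apply: eq_bigr => i _; rewrite !mxE; ring.
case/andP: t01 => t0 _.
by rewrite sqrtrM ?sqr_ge0 // sqrtr_sqr ger0_norm.
Qed.

End Comparison.

(** * Iterated geodesic cones *)

Section IteratedCone.
Variables (R : realType) (X : metricType R) (gam : X -> X -> R -> X).
Hypotheses (hX : CAT0 X) (gamP : forall x y, geodesic x y (gam x y)).
Variable y : nat -> X.

Let mass (t : nat -> R) (k : nat) : R := \sum_(i < k.+1) t i.

(* Since [0 / 0 = 0], this is [y k] when [t 0, .., t k] all vanish. *)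
Fixpoint iterated_cone (t : nat -> R) (k : nat) : X :=
  if k is k'.+1 then
    gam (y k) (iterated_cone t k') (mass t k' / mass t k)
  else y 0%N.

Let massS t k : mass t k.+1 = mass t k + t k.+1.
Proof. by rewrite /mass big_ord_recr. Qed.

Let mass_ge0 t k : (forall i, 0 <= t i) -> 0 <= mass t k.
Proof. by move=> t0; apply: sumr_ge0. Qed.

Let ratio01 t k : (forall i, 0 <= t i) -> 0 <= mass t k / mass t k.+1 <= 1.
Proof.
move=> t0; have m_ge0 := mass_ge0 _ t0; rewrite divr_ge0 ?m_ge0 //=.
have [->|m0] := eqVneq (mass t k.+1) 0.
  by rewrite invr0 mulr0.
by rewrite ler_pdivrMr ?mul1r ?massS ?lerDl // -massS lt_neqAle eq_sym m0 m_ge0.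
Qed.

Let ratioK t k : (forall i, 0 <= t i) ->
  mass t k / mass t k.+1 * mass t k.+1 = mass t k.
Proof.
move=> t0.
have [m0|m0] := eqVneq (mass t k.+1) 0; last by rewrite divfK.
rewrite m0 mulr0; apply/esym/eqP; rewrite eq_le mass_ge0 // andbT -m0 massS.
by rewrite lerDl.
Qed.

(** Vertices of weight zero have no influence: if [t k.+1 = 0] the ratio is 1 and the previous cone
    point is kept; if the previous mass is 0 the ratio is 0 and the new vertex is reached. *)
Lemma iterated_cone_hull (t : nat -> R) k (C : set X) :
  (forall i, 0 <= t i) -> geodesically_convex C ->
  (forall i, (i <= k)%N -> 0 < t i -> C (y i)) -> 0 < mass t k ->
  C (iterated_cone t k).
Proof.
move=> t0 Cc; elim: k => [|k IH] Cy m0 /=.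
  by apply: Cy => //; move: m0; rewrite /mass big_ord_recl big_ord0 addr0.
have [g0 g1 _] := gamP (y k.+1) (iterated_cone t k).
have [tk|tk] := eqVneq (t k.+1) 0.
  move: m0; rewrite massS tk addr0 => m0.
  rewrite divff ?gt_eqF // g1; apply: IH => // i ik; apply: Cy.
  exact: leq_trans ik _.
have yk : C (y k.+1) by apply: Cy => //; rewrite lt_neqAle eq_sym tk t0.
have [mk|mk] := eqVneq (mass t k) 0; first by rewrite mk mul0r g0.
apply: (Cc _ _ _ yk _ (gamP _ _) _ (ratio01 k t0)).
apply: IH => [i ik|]; first by apply: Cy; apply: leq_trans ik _.
by rewrite lt_neqAle eq_sym mk mass_ge0.
Qed.

(** The bound does not depend on the weights, so it is uniform over the simplex. *)
Lemma iterated_cone_dist (t : nat -> R) k j : (forall i, 0 <= t i) ->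
  mdist (y j) (iterated_cone t k) <=
    mdist (y j) (y k) + \sum_(i < k) mdist (y i.+1) (y i).
Proof.
move=> t0; elim: k j => [|k IH] j /=; first by rewrite big_ord0 addr0.
apply: le_trans (@metric_triangle R X _ (y k.+1) _) _; rewrite lerD2l.
have [g0 _ gd] := gamP (y k.+1) (iterated_cone t k).
rewrite -[X in mdist X _]g0 gd ?ratio01 ?lexx ?ler01 // sub0r normrN.
case/andP: (ratio01 k t0) => r0 r1.
rewrite ger0_norm // (le_trans (ler_piMl _ r1)) ?mdist_ge0 //.
by rewrite (le_trans (IH _)) // big_ord_recr /= addrC.
Qed.

Let mass_dist t u k : `|mass t k - mass u k| <= mass (fun i => `|t i - u i|) k.
Proof. by rewrite /mass -sumrB ler_norm_sum. Qed.

(* The factor [mass t k] compensates the discontinuity of the cone at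
   vanishing weights. *)
Lemma iterated_cone_lipschitz k : exists2 L, 0 <= L & forall t u : nat -> R,
  (forall i, 0 <= t i) -> (forall i, 0 <= u i) ->
  (\sum_(i < k.+1) t i) * mdist (iterated_cone t k) (iterated_cone u k) <=
  L * \sum_(i < k.+1) `|t i - u i|.
Proof.
elim: k => [|k [L L0 IH]].
  by exists 0 => // t u t0 u0 /=; rewrite mdistxx mulr0 mul0r.
pose D := mdist (y k.+1) (y k) + \sum_(i < k) mdist (y i.+1) (y i).
have D0 : 0 <= D.
  by rewrite addr_ge0 ?mdist_ge0 // sumr_ge0 // => i _; apply: mdist_ge0.
exists (L + 2 * D) => [|t u t0 u0]; first by rewrite addr_ge0 // mulr_ge0.
rewrite -!/(mass _ k.+1) -/(mass (fun i => `|t i - u i|) k.+1) /=.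
set P := iterated_cone t k; set Q := iterated_cone u k.
set r := mass t k / mass t k.+1; set r' := mass u k / mass u k.+1.
pose delta := mass (fun i => `|t i - u i|).
have m0 : 0 <= mass t k.+1 by apply: sumr_ge0.
have deltaS : delta k <= delta k.+1 by rewrite /delta massS lerDl.
have delta0 : 0 <= delta k.+1 by apply: sumr_ge0.
have r01 : 0 <= r <= 1 by apply: ratio01.
have r'01 : 0 <= r' <= 1 by apply: ratio01.
have [_ _ hd] := gamP (y k.+1) Q.
(* The intermediate point [gam (y k.+1) Q r] separates a change of geodesic at a fixed parameter
   from a change of parameter on a fixed geodesic. *)
have dist_le : mdist (gam (y k.+1) P r) (gam (y k.+1) Q r') <=
    r * mdist P Q + `|r - r'| * D.
  apply: le_trans (@metric_triangle R X _ (gam (y k.+1) Q r) _) _.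
  rewrite lerD //; first exact: CAT0_fan.
  by rewrite hd // ler_wpM2l // iterated_cone_dist.
have rm : r * mass t k.+1 = mass t k by apply: ratioK.
have rm' : r' * mass u k.+1 = mass u k by apply: ratioK.
clearbody r r'; apply: le_trans (ler_wpM2l m0 dist_le) _.
rewrite mulrDr !mulrA [mass t k.+1 * r]mulrC rm mulrDl lerD //.
  apply: le_trans (IH t u t0 u0) _; by rewrite ler_wpM2l.
rewrite -[2 * D * _]mulrA [D * _]mulrC mulrA ler_wpM2r //.
rewrite -[X in X * _]ger0_norm // -normrM mulrBr [mass t k.+1 * r]mulrC rm.
(* Two differences of masses, each at most [delta k.+1]: hence the factor 2 in [L + 2 * D]. *)
have -> : mass t k - mass t k.+1 * r' =
    (mass t k - mass u k) + r' * (mass u k.+1 - mass t k.+1).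
  by rewrite -rm'; ring.
apply: le_trans (ler_normD _ _) _; rewrite mulr2n mulrDl mul1r lerD //.
  exact: le_trans (mass_dist _ _ _) deltaS.
case/andP: r'01 => r'0 r'1.
rewrite normrM (ger0_norm r'0) (le_trans (ler_piMl _ r'1)) //.
by rewrite distrC mass_dist.
Qed.

End IteratedCone.

(** * Equilibria *)

(** The distances to the [G i], composed with the iterated cone, satisfy the hypotheses of
    [kkm_simplex]: the covering is used with [J] the set of positive coordinates. *)
Lemma CAT0_kkm (R : realType) (X : metricType R) (n : nat)
    (y : 'I_n.+1 -> X) (G : 'I_n.+1 -> set X) :
  CAT0 X -> (forall i, closed (G i)) ->
  (forall J : set 'I_n.+1, J !=set0 ->
     smallest (@geodesically_convex R X) (y @` J) `<=` \bigcup_(i in J) G i) ->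
  exists z, forall i, G i z.
Proof.
move=> hX Gcl cover.
have Gy i : G i (y i).
  have [||j -> //] := cover [set i] _ (y i); first by exists i.
  by move=> C [_ Cy]; apply: Cy; exists i.
have G0 i : G i !=set0 by exists (y i).
(* A single vertex is treated apart, as [kkm_simplex] asks for at least two coordinates. *)
case: n => [|n] in y G Gcl cover Gy G0 *.
  by exists (y ord0) => i; rewrite ord1.
have [gam gamP] : exists gam, forall x z, @geodesic R X x z (gam x z).
  have /choice[f fP] : forall p : X * X, exists g, geodesic p.1 p.2 g.
    by move=> p; apply: hX.1.
  by exists (fun x z => f (x, z)) => x z; apply: (fP (x, z)).
pose yn (i : nat) := y (inord i).
pose w (x : 'rV[R]_n.+2) (i : nat) := x ord0 (inord i).
pose phi x := iterated_cone gam yn (w x) n.+1.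
have w_sum x : \sum_(i < n.+2) w x i = \sum_i x ord0 i.
  by apply: eq_bigr => i _; rewrite /w inord_val.
have w_ge0 x : simplex x -> forall i, 0 <= w x i by move=> [x0 _] i; apply: x0.
have [L L0 lip] := iterated_cone_lipschitz hX gamP yn n.+1.
have phi_lip x z : simplex x -> simplex z ->
    mdist (phi x) (phi z) <= L * n.+2%:R * `|x - z|.
  move=> xs zs; have := lip (w x) (w z) (w_ge0 x xs) (w_ge0 z zs).
  rewrite w_sum xs.2 mul1r => /le_trans; apply.
  rewrite -mulrA ler_wpM2l //.
  apply: (@le_trans _ _ (\sum_(i < n.+2) `|x - z|)); last first.
    by rewrite sumr_const card_ord mulr_natl.
  apply: ler_sum => i _; have := coord_le_norm (x - z) (inord i).
  by rewrite !mxE.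
pose b i := mdist (yn i) (yn n.+1) + \sum_(j < n.+1) mdist (yn j.+1) (yn j).
have b_ge0 i : 0 <= b i.
  by rewrite addr_ge0 ?mdist_ge0 // sumr_ge0 // => j _; apply: mdist_ge0.
have [||||||x xs dx] := @kkm_simplex R n.+2 (fun i x => set_dist (G i) (phi x))
  (L * n.+2%:R) (\sum_(i < n.+2) b i) _ _ _ _ _ _ => //.
- by rewrite mulr_ge0.
- by apply: sumr_ge0.
- move=> x i xs; rewrite set_dist_ge0 //=.
  apply: le_trans (set_dist_le (G0 i) _ (Gy i)) _.
  rewrite metric_sym (bigD1 i) //= -[leLHS]addr0 lerD ?sumr_ge0 //.
  by rewrite -{1}(inord_val i); apply: iterated_cone_dist => //; apply: w_ge0.
- move=> x z i xs zs; apply: le_trans (phi_lip x z xs zs).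
  exact: set_dist_lipschitz.
- move=> x xs.
  have [||i /= xi Gi] := cover [set i | 0 < x ord0 i] _ (phi x).
  + apply: contrapT => no; have := xs.2; apply/eqP.
    rewrite big1 1?eq_sym ?oner_eq0 // => i _; apply/eqP.
    rewrite eq_le xs.1 andbT leNgt; apply/negP => xi; apply: no.
    by exists i.
  + move=> C [Cc Cy]; apply: (iterated_cone_hull gamP) => //.
    * exact: w_ge0.
    * by move=> i _ xi; apply: Cy; exists (inord i).
    * by rewrite w_sum xs.2.
  + by exists i; rewrite set_dist_mem.
exists (phi x) => i; exact: set_dist_eq0 (dx i).
Qed.

Section Equilibrium.
Variables (R : realType) (X : metricType R) (K : set X) (F : X -> X -> R).

Lemma closed_superlevel (h : X -> R) : closed K ->
  upper_semicontinuous_on K h -> closed [set x | K x /\ 0 <= h x].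
Proof.
move=> Kcl husc x clx.
have Kx : K x by apply: Kcl; apply: closureS clx => z [].
split=> //; rewrite leNgt; apply/negP => hx.
have := husc x 0 Kx hx; rewrite near_withinE => /clx[z [[Kz hz] /(_ Kz)]].
by rewrite ltNge hz.
Qed.

Hypotheses (hX : CAT0 X) (Kclosed : closed K) (Kconvex : geodesically_convex K).
Hypothesis A1 : forall x, K x -> 0 <= F x x.
Hypothesis A2 : forall x, K x -> geodesically_convex [set y | K y /\ F x y < 0].
Hypothesis A3 : forall y, K y -> upper_semicontinuous_on K (F^~ y).

(** If [z] in the hull of some [y i] had all the corresponding [F z (y i)] negative, [A2] would give
    [F z z < 0], against [A1]. *)
Lemma finite_equilibrium n (y : 'I_n.+1 -> X) : (forall i, K (y i)) ->
  exists z, K z /\ forall i, 0 <= F z (y i).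
Proof.
move=> Ky.
have [||z Gz] :=
  @CAT0_kkm R X n y (fun i => [set z | K z /\ 0 <= F z (y i)]) hX.
- by move=> i; apply: closed_superlevel => //; apply: A3.
- move=> J [i0 Ji0] z zJ.
  have Kz : K z by apply: zJ; split=> // _ [i _ <-].
  apply: contrapT => no.
  have [_] : [set u | K u /\ F z u < 0] z.
    apply: zJ; split; first exact: A2.
    move=> _ [i Ji <-]; split=> //; rewrite ltNge; apply/negP => Fi.
    by apply: no; exists i.
  by rewrite ltNge A1.
by exists z; split=> [|i]; [case: (Gz ord0)|case: (Gz i)].
Qed.

(** The sets [G y] meeting [G y0] have the finite intersection property and generate a filter
    containing [L]. A cluster point in [L] belongs to every closed [G y]. *)
Lemma equilibrium_exists (L : set X) (y0 : X) : compact L -> L `<=` K -> L y0 ->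
  (forall x, (K `\` L) x -> F x y0 < 0) -> equilibria K F !=set0.
Proof.
move=> Lc LK Ly0 out; pose G y := [set x | K x /\ 0 <= F x y].
have Ky0 := LK y0 Ly0.
have Gy0L : G y0 `<=` L.
  move=> x [Kx Fx]; apply: contrapT => xL.
  by have := out x (conj Kx xL); rewrite ltNge Fx.
have Gcl y : K y -> closed (G y) by move=> /A3; apply: closed_superlevel.
have fin : finI K (fun y => G y `&` G y0).
  (* Putting [y0] first makes the list nonempty and the common point a member of [G y0]. *)
  move=> D DK; pose r := y0 :: finmap.enum_fset D.
  have Kr u : u \in r -> K u by rewrite inE => /orP[/eqP->//|/DK]; rewrite inE.
  have [z [Kz Fz]] : exists z, K z /\
      forall i : 'I_(size (finmap.enum_fset D)).+1, 0 <= F z (nth y0 r i).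
    by apply: finite_equilibrium => i; apply/Kr/mem_nth.
  have Fr u : u \in r -> 0 <= F z u.
    move=> ur; have := ur; rewrite -index_mem => iu.
    by have := Fz (Ordinal iu); rewrite nth_index.
  exists z => u /= uD; split; split=> //; apply: Fr; rewrite inE ?eqxx //.
  by apply/orP; right.
have in_filter y : K y ->
    filter_from (finI_from K (fun y => G y `&` G y0)) id (G y `&` G y0).
  by move=> Ky; exists (G y `&` G y0) => //; apply: finI_from1.
have PF := finI_filter fin.
have [|p [Lp clp]] := Lc _ PF.
  by apply: filterS (in_filter y0 Ky0) => x [_ /Gy0L].
exists p; split; first exact: LK.
move=> y Ky; suff [] : G y p by [].
apply: (Gcl y Ky) => B pB.
have [x [[Gx _] Bx]] := clp _ _ (in_filter y Ky) pB.
by exists x.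
Qed.

Lemma closed_equilibria : closed (equilibria K F).
Proof.
have -> : equilibria K F =
    K `&` \bigcap_(y in K) [set x | K x /\ 0 <= F x y].
  apply/seteqP; split=> x [Kx Fx]; split=> // y Ky.
    by split=> //; apply: Fx.
  by case: (Fx y Ky).
apply: closedI => //; apply: closed_bigI => y Ky.
exact: closed_superlevel (A3 Ky).
Qed.

Lemma convex_equilibria : (forall y, K y -> quasi_concave K (F^~ y)) ->
  geodesically_convex (equilibria K F).
Proof.
move=> qc x z g [Kx Fx] [Kz Fz] xzg t t01.
split; first exact: Kconvex xzg t t01.
move=> y Ky.
have [g0 g1 _] := xzg.
(* With endpoint parameters 0 and 1, the combination of weight [t] is [t] itself. *)
have := qc y Ky x z g Kx Kz xzg 0 1 t.
rewrite /= lexx ler01 lexx mulr0 mulr1 add0r g0 g1 => /(_ isT isT t01).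
by rewrite le_max !lerN2 => /orP[]; apply: le_trans; [apply: Fx|apply: Fz].
Qed.

End Equilibrium.

Theorem theorem4p1 (R : realType) (X : metricType R) (K : set X)
    (F : X -> X -> R)
    (hX : hadamard_space X)
    (K0 : K !=set0) (Kclosed : closed K) (Kconvex : geodesically_convex K)
    (A1 : forall x : X, K x -> 0 <= F x x)
    (A2 : forall x : X, K x ->
       geodesically_convex [set y : X | K y /\ F x y < 0])
    (A3 : forall y : X, K y -> upper_semicontinuous_on K (fun x => F x y))
    (A4 : exists L : set X, [/\ compact L, L `<=` K &
       exists y0 : X, L y0 /\ forall x : X, (K `\` L) x -> F x y0 < 0]) :
  [/\ equilibria K F !=set0,
      closed (equilibria K F) &
      (forall y : X, K y -> quasi_concave K (fun x => F x y)) ->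
        geodesically_convex (equilibria K F)].
Proof.
have [L [Lc LK [y0 [Ly0 out]]]] := A4.
split.
- exact: (equilibrium_exists hX.2 Kclosed Kconvex A1 A2 A3 Lc LK Ly0 out).
- exact: closed_equilibria Kclosed A3.
- exact: convex_equilibria Kconvex.
Qed.
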